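(* For $n\ge3$, the braid group $\mathbb B_n$ is presented by generators $\gamma_1,\dots,\gamma_{n-1}$ subject to the defining relations $$\gamma_l\gamma_{l-1}(\gamma_{l-2}\gamma_{l-3}\cdots\gamma_{k+1}\gamma_k)\gamma_l=\gamma_{l-1}(\gamma_{l-2}\gamma_{l-3}\cdots\gamma_{k+1}\gamma_k)\gamma_l\gamma_{l-1}\qquad\text{for }0<k<l<n.$$
   Context: $\mathbb B_n$ is Artin's braid group, i.e. the group presented by generators $\sigma_1,\dots,\sigma_{n-1}$ subject to $\sigma_i\sigma_j\sigma_i=\sigma_j\sigma_i\sigma_j$ if $|i-j|=1$ and $\sigma_i\sigma_j=\sigma_j\sigma_i$ if $|i-j|>1$. For $k=l-1$ the product in parentheses is empty, so that the relation reads $\gamma_l\gamma_{l-1}\gamma_l=\gamma_{l-1}\gamma_l\gamma_{l-1}$. *)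

(* Defs.v *)
From HB Require Import structures.
From mathcomp Require Import all_boot.
From mathcomp Require Import boolp.

Set Implicit Arguments.
Unset Strict Implicit.
Unset Printing Implicit Defensive.

Local Open Scope quotient_scope.

(* A letter (x, false) stands for the generator x, and (x, true) for x^-1.
   [rel u v] says that u = v is one of the defining relations. *)
Definition word (X : choiceType) := seq (X * bool).

Section PresentedGroup.
Variables (X : choiceType) (rel : word X -> word X -> Prop).

(* The congruence on words whose classes are the elements of < X | rel >. *)
Inductive word_eq : word X -> word X -> Prop :=
| word_eq_refl u : word_eq u u
| word_eq_sym u v : word_eq u v -> word_eq v u
| word_eq_trans u v w : word_eq u v -> word_eq v w -> word_eq u w
| word_eq_cat u u' v v' :
    word_eq u u' -> word_eq v v' -> word_eq (u ++ v) (u' ++ v')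
| word_eq_cancel x b : word_eq [:: (x, b); (x, ~~ b)] [::]
| word_eq_rel u v : rel u v -> word_eq u v.

Definition word_eqb (u v : word X) : bool := `[< word_eq u v >].

Lemma word_eqb_refl : reflexive word_eqb.
Proof. by move=> u; apply/asboolP/word_eq_refl. Qed.

Lemma word_eqb_sym : symmetric word_eqb.
Proof. by move=> u v; apply/asboolP/asboolP => /word_eq_sym. Qed.

Lemma word_eqb_trans : transitive word_eqb.
Proof.
move=> v u w /asboolP uv /asboolP vw.
exact/asboolP/(word_eq_trans uv vw).
Qed.

Canonical word_equiv :=
  EquivRel word_eqb word_eqb_refl word_eqb_sym word_eqb_trans.

Definition presented_group := {eq_quot word_equiv}.

HB.instance Definition _ := Choice.on presented_group.
HB.instance Definition _ := EqQuotient.on presented_group.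

Definition pg_class (u : word X) : presented_group := \pi_presented_group u.

Lemma pg_classP u v : pg_class u = pg_class v <-> word_eq u v.
Proof.
rewrite /pg_class; split=> [/eqmodP|uv]; first by move/asboolP.
by apply/eqmodP/asboolP.
Qed.

Lemma pg_classK a : pg_class (repr a) = a.
Proof. exact: reprK. Qed.

Definition inv_word (u : word X) : word X :=
  rev [seq (p.1, ~~ p.2) | p <- u].

Lemma inv_word_cat u v : inv_word (u ++ v) = inv_word v ++ inv_word u.
Proof. by rewrite /inv_word map_cat rev_cat. Qed.

Lemma inv_wordK : involutive inv_word.
Proof.
move=> u; rewrite /inv_word map_rev revK -map_comp -[RHS]map_id.
by apply: eq_map => -[x b] /=; rewrite negbK.
Qed.

Lemma word_eq_mulV u : word_eq (u ++ inv_word u) [::].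
Proof.
elim: u => [|[x b] u IH]; first exact: word_eq_refl.
rewrite -cat1s inv_word_cat -catA.
apply: word_eq_trans (word_eq_cancel x b).
apply: (@word_eq_cat [:: (x, b)] [:: (x, b)] _ [:: (x, ~~ b)]).
  exact: word_eq_refl.
rewrite -[X in word_eq _ X]cat0s catA.
exact: (word_eq_cat IH (word_eq_refl _)).
Qed.

Lemma word_eq_Vmul u : word_eq (inv_word u ++ u) [::].
Proof. by rewrite -{2}[u]inv_wordK; apply: word_eq_mulV. Qed.

Lemma word_eq_inv u v : word_eq u v -> word_eq (inv_word u) (inv_word v).
Proof.
move=> uv; have e1 : word_eq (inv_word u) (inv_word u ++ v ++ inv_word v).
  rewrite -{1}[inv_word u]cats0.
  exact/(word_eq_cat (word_eq_refl _))/word_eq_sym/word_eq_mulV.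
apply: (word_eq_trans e1); rewrite catA -[X in word_eq _ X]cat0s.
apply: word_eq_cat (word_eq_refl _).
apply: word_eq_trans (word_eq_Vmul u).
exact: word_eq_cat (word_eq_refl _) (word_eq_sym uv).
Qed.

Definition pg_one := pg_class [::].
Definition pg_mul (a b : presented_group) := pg_class (repr a ++ repr b).
Definition pg_inv (a : presented_group) := pg_class (inv_word (repr a)).

Lemma word_eq_repr u : word_eq (repr (pg_class u)) u.
Proof. by apply/pg_classP; rewrite pg_classK. Qed.

Lemma pg_mulE u v : pg_mul (pg_class u) (pg_class v) = pg_class (u ++ v).
Proof. by apply/pg_classP; apply: word_eq_cat; apply: word_eq_repr. Qed.

Lemma pg_invE u : pg_inv (pg_class u) = pg_class (inv_word u).
Proof. exact/pg_classP/word_eq_inv/word_eq_repr. Qed.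

Lemma pg_mulA : associative pg_mul.
Proof.
move=> a b c; rewrite -[a]pg_classK -[b]pg_classK -[c]pg_classK.
by rewrite !pg_mulE catA.
Qed.

Lemma pg_mul1 : left_id pg_one pg_mul.
Proof. by move=> a; rewrite -[a]pg_classK /pg_one pg_mulE. Qed.

Lemma pg_mulr1 : right_id pg_one pg_mul.
Proof. by move=> a; rewrite -[a]pg_classK /pg_one pg_mulE cats0. Qed.

Lemma pg_mulV : left_inverse pg_one pg_inv pg_mul.
Proof.
move=> a; rewrite -[a]pg_classK pg_invE pg_mulE.
exact/pg_classP/word_eq_Vmul.
Qed.

Lemma pg_mulrV : right_inverse pg_one pg_inv pg_mul.
Proof.
move=> a; rewrite -[a]pg_classK pg_invE pg_mulE.
exact/pg_classP/word_eq_mulV.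
Qed.

HB.instance Definition _ := isGroup.Build presented_group
  pg_mulA pg_mul1 pg_mulr1 pg_mulV pg_mulrV.

Definition pg_gen (x : X) : presented_group := pg_class [:: (x, false)].

End PresentedGroup.

(* The group G is presented by the generators g x, x : X, subject to rel:
   the assignment x |-> g x induces an isomorphism < X | rel > -> G. *)
Definition presented_by (X : choiceType) (rel : word X -> word X -> Prop)
    (G : groupType) (g : X -> G) : Prop :=
  exists f : {multiplicative presented_group rel -> G},
    bijective f /\ forall x, f (pg_gen rel x) = g x.

Definition pos_word (X : choiceType) (s : seq X) : word X :=
  [seq (x, false) | x <- s].

(* The indices 1, ..., n - 1. *)
Definition gen_index (n : nat) := {i : nat | 0 < i < n}.

Inductive artin_rel (n : nat) : word (gen_index n) -> word (gen_index n) -> Prop :=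
| artin_braid (i j : gen_index n) :
    val i = (val j).+1 \/ val j = (val i).+1 ->
    artin_rel (pos_word [:: i; j; i]) (pos_word [:: j; i; j])
| artin_comm (i j : gen_index n) :
    (val i).+1 < val j \/ (val j).+1 < val i ->
    artin_rel (pos_word [:: i; j]) (pos_word [:: j; i]).

Arguments artin_rel : clear implicits.

Definition braid_group (n : nat) : groupType := presented_group (artin_rel n).

(* The indices l - 2, l - 3, ..., k + 1, k; empty for k = l - 1. *)
Definition descent (k l : nat) : seq nat := rev (iota k (l.-1 - k)).

(* gamma_l gamma_{l-1} (gamma_{l-2} ... gamma_k) gamma_l
   = gamma_{l-1} (gamma_{l-2} ... gamma_k) gamma_l gamma_{l-1} *)
Inductive gamma_rel (n : nat) : word (gen_index n) -> word (gen_index n) -> Prop :=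
| gamma_relation (k l : nat) (s t : seq (gen_index n)) :
    0 < k -> k < l -> l < n ->
    map val s = [:: l; l.-1] ++ descent k l ++ [:: l] ->
    map val t = [:: l.-1] ++ descent k l ++ [:: l; l.-1] ->
    gamma_rel (pos_word s) (pos_word t).

Arguments gamma_rel : clear implicits.

(* Main.v *)
From HB Require Import structures.
Require Import Defs.
From mathcomp Require Import all_boot.

Set Implicit Arguments.
Unset Strict Implicit.
Unset Printing Implicit Defensive.

(** Write s_1, ..., s_(n-1) for the Artin generators, and define
        gamma_1 = s_1,   gamma_i = gamma_(i-1) s_i gamma_(i-1)^-1,
    so that gamma_i = (s_1 ... s_(i-1)) s_i (s_1 ... s_(i-1))^-1 is the band
    generator which exchanges the strands 1 and i + 1.  The substitution is
    invertible: s_i = gamma_(i-1)^-1 gamma_i gamma_(i-1).  It therefore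
    suffices to show that, for two families in an arbitrary group linked by
    gamma_i gamma_(i-1) = gamma_(i-1) s_i, the relations of the statement hold
    for gamma if and only if the Artin relations hold for s; the two
    substitutions then induce mutually inverse morphisms between the two
    presented groups ([presented_by_inverse]).

    The equivalence passes through a third, mixed system: s_l braids with
    gamma_(l-1) and commutes with gamma_i for 0 < i < l - 1.

    - It is equivalent to the relations of the statement
      ([linked_gamma_relations]).  With c = gamma_l, b = gamma_(l-1), x = s_l
      and w = gamma_(l-2) ... gamma_k we have c b = b x.  When w is empty the
      relation c b w c = b w c b says that x and b braid; given that, for
      general w it says that x commutes with w.  Commuting with all the
      descending products w amounts to commuting with all their factors.

    - It is equivalent to the Artin relations ([linked_braid_relations]).
      Commuting with gamma_i for all i < l - 1 is the same as commuting with s_i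
      for all i < l - 1, since each family is a triangular substitution in the
      other; and then s_l commutes with gamma_(l-2), which conjugates
      s_(l-1) to gamma_(l-1), so that s_l braids with one of these two
      elements if and only if it braids with the other.

    Families are indexed by all of nat with value 1 at index 0, so that
    gamma_1 = s_1 is the case i = 1 of the general recursion. *)

(** * Presented groups: universal property and change of generators *)

Section Lift.
Local Open Scope group_scope.
Variables (X : choiceType) (rel : word X -> word X -> Prop).

Definition eval (G : groupType) (a : X -> G) (u : word X) : G :=
  \prod_(p <- u) (if p.2 then (a p.1)^-1 else a p.1).

Lemma eval_cat (G : groupType) (a : X -> G) u v :
  eval a (u ++ v) = eval a u * eval a v.
Proof. exact: big_cat. Qed.

Definition respects (G : groupType) (a : X -> G) : Prop :=
  forall u v, rel u v -> eval a u = eval a v.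

Lemma eval_word_eq (G : groupType) (a : X -> G) :
  respects a -> forall u v, word_eq rel u v -> eval a u = eval a v.
Proof.
move=> rel_a u v; elim=> {u v} //.
- by move=> u v w _ -> _ ->.
- by move=> u u' v v' _ Eu _ Ev; rewrite !eval_cat Eu Ev.
- by move=> x [] ; rewrite /eval !big_cons big_nil /= mulg1 ?mulVg ?mulgV.
Qed.

Lemma eval_pg_gen u : eval (pg_gen rel) u = pg_class rel u.
Proof.
elim: u => [|[x b] u IH]; first by rewrite /eval big_nil.
rewrite -cat1s eval_cat {}IH /eval big_seq1 -pg_mulE; congr (_ * _) => /=.
by case: b => //; apply: (pg_invE rel [:: (x, false)]).
Qed.

Lemma respects_pg_gen : respects (pg_gen rel).
Proof. by move=> u v uv; rewrite !eval_pg_gen; apply/pg_classP/word_eq_rel. Qed.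

Lemma presented_group_lift (G : groupType) (a : X -> G) :
  respects a ->
  exists f : {multiplicative presented_group rel -> G},
    forall x, f (pg_gen rel x) = a x.
Proof.
move=> rel_a; pose f (c : presented_group rel) := eval a (repr c).
have fE u : f (pg_class rel u) = eval a u.
  exact/(eval_word_eq rel_a)/word_eq_repr.
have fM : {morph f : x y / x * y}.
  move=> x y; rewrite -[x]pg_classK -[y]pg_classK.
  by rewrite [_ * _]pg_mulE !fE eval_cat.
exists (HB.pack_for {multiplicative presented_group rel -> G} f
  (isMultiplicative.Build _ _ f fM)) => x /=.
by rewrite fE /eval big_seq1.
Qed.

Lemma multiplicative1 (G H : groupType) (f : {multiplicative G -> H}) : f 1 = 1.
Proof. by apply: (mulgI (f 1)); rewrite -gmulfM !mulg1. Qed.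

Lemma multiplicativeV (G H : groupType) (f : {multiplicative G -> H}) :
  {morph f : x / x^-1}.
Proof.
by move=> x; apply/esym/mulg1_eq; rewrite -gmulfM mulgV multiplicative1.
Qed.

Lemma eval_morph (G H : groupType) (f : {multiplicative G -> H}) a u :
  f (eval a u) = eval (f \o a) u.
Proof.
rewrite /eval (big_morph f gmulfM (multiplicative1 f)).
by apply: eq_bigr => -[x []] _ //=; rewrite multiplicativeV.
Qed.

(** Every element of a presented group is the evaluation of a word in the
    generators, and morphisms commute with evaluation. *)
Lemma presented_group_ext (G : groupType)
    (f f' : {multiplicative presented_group rel -> G}) :
  (forall x, f (pg_gen rel x) = f' (pg_gen rel x)) -> f =1 f'.
Proof.
move=> ff' c; rewrite -[c]pg_classK -eval_pg_gen !eval_morph.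
by apply: eq_bigr => -[x b] _ /=; rewrite ff'.
Qed.

End Lift.

(** Tietze's criterion: if the generators of each presentation are rewritten in
    terms of the other so that the relations are respected, and the two
    rewritings undo each other on generators, then the lifts are mutually
    inverse.  The last two hypotheses quantify over all lifts because a lift is
    only known to exist, and is used only through its values on generators. *)
Lemma presented_by_inverse (X Y : choiceType) (relX : word X -> word X -> Prop)
    (relY : word Y -> word Y -> Prop)
    (a : X -> presented_group relY) (b : Y -> presented_group relX) :
  respects relX a -> respects relY b ->
  (forall f : {multiplicative presented_group relX -> presented_group relY},
     (forall x, f (pg_gen relX x) = a x) ->
     forall y, f (b y) = pg_gen relY y) ->
  (forall h : {multiplicative presented_group relY -> presented_group relX},
     (forall y, h (pg_gen relY y) = b y) ->
     forall x, h (a x) = pg_gen relX x) ->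
  presented_by relX a.
Proof.
move=> rel_a rel_b ab ba.
have [f fE] := presented_group_lift rel_a.
have [h hE] := presented_group_lift rel_b.
exists f; split=> //; exists h.
  apply: (@presented_group_ext _ _ _ (h \o f) idfun) => x /=.
  by rewrite fE ba.
apply: (@presented_group_ext _ _ _ (f \o h) idfun) => y /=.
by rewrite hE ab.
Qed.

(** * Equivalence of the relations for linked families *)

Section Families.
Local Open Scope group_scope.
Variable G : groupType.
Implicit Types (x y z : G) (g s t : nat -> G) (n : nat).

Definition braided x y : Prop := x * y * x = y * x * y.

Lemma braidedJ x y z : braided (x ^ z) (y ^ z) <-> braided x y.
Proof.
rewrite /braided -!conjMg; split=> [|-> //]; exact: conjg_inj.
Qed.

(** Two families are allowed so as to cover both the Artin relations, when [t]
    is [s], and the mixed system, when [t] is the family of the gamma_i. *)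
Definition braid_relations n s t : Prop :=
  (forall i, 0 < i -> i.+1 < n -> braided (s i.+1) (t i)) /\
  (forall i j, 0 < i -> i.+1 < j -> j < n -> commute (s j) (t i)).

Definition gamma_relations n g : Prop :=
  forall k l, 0 < k -> k < l -> l < n ->
    g l * g l.-1 * (\prod_(i <- descent k l) g i) * g l
    = g l.-1 * (\prod_(i <- descent k l) g i) * g l * g l.-1.

(** The change of generators, stated symmetrically: either family determines the
    other, and the property is preserved by morphisms. *)
Record linked g s : Prop := Linked {
  linked_g0 : g 0 = 1;
  linked_s0 : s 0 = 1;
  linkedM : forall i, g i.+1 * g i = g i * s i.+1 }.

Lemma linkedJ g s : linked g s -> forall i, s i.+1 = g i.+1 ^ g i.
Proof. by move=> gs i; rewrite conjgE (linkedM gs) mulKg. Qed.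

Lemma linkedJV g s : linked g s -> forall i, g i.+1 = s i.+1 ^ (g i)^-1.
Proof. by move=> gs i; rewrite (linkedJ gs) conjgK. Qed.

Fixpoint gammas s i : G :=
  if i is j.+1 then s j.+1 ^ (gammas s j)^-1 else 1.

Definition sigmas g i : G := g i ^ g i.-1.

Lemma linked_gammas s : s 0 = 1 -> linked (gammas s) s.
Proof. by move=> s0; split=> // i /=; rewrite conjgE invgK mulgA mulgVK. Qed.

Lemma linked_sigmas g : g 0 = 1 -> linked g (sigmas g).
Proof.
by move=> g0; split=> // [|i]; [rewrite /sigmas g0 conj1g | apply: conjgC].
Qed.

Lemma linked_eql n g g' s s' : linked g s -> linked g' s' ->
  (forall i, i < n -> s i = s' i) -> forall i, i < n -> g i = g' i.
Proof.
move=> gs gs' ss'; elim=> [|i IH] lt_in.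
  by rewrite (linked_g0 gs) (linked_g0 gs').
by rewrite (linkedJV gs) (linkedJV gs') IH 1?ltnW // ss'.
Qed.

Lemma linked_eqr n g g' s s' : linked g s -> linked g' s' ->
  (forall i, i < n -> g i = g' i) -> forall i, i < n -> s i = s' i.
Proof.
move=> gs gs' gg' [|i] lt_in; first by rewrite (linked_s0 gs) (linked_s0 gs').
by rewrite (linkedJ gs) (linkedJ gs') !gg' // ltnW.
Qed.

Lemma commuteJ x y z : commute x y -> commute x z -> commute x (y ^ z).
Proof. by move=> xy xz; do 2?apply: commuteM => //; apply: commuteV. Qed.

(** Each [s i] is a word in the [g j], and each [g i] a word in the [s j], with
    [j <= i] in both cases. *)
Lemma linked_commute g s x m : linked g s ->
  (forall i, i < m -> commute x (g i)) <-> (forall i, i < m -> commute x (s i)).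
Proof.
move=> gs; split=> xC.
  case=> [|i] lt_im; first by rewrite (linked_s0 gs); apply: commute1.
  by rewrite (linkedJ gs); apply: commuteJ; apply: xC => //; apply: ltnW.
elim=> [|i IH] lt_im; first by rewrite (linked_g0 gs); apply: commute1.
rewrite (linkedJV gs); apply: commuteJ; first exact: xC.
by apply/commuteV/IH/ltnW.
Qed.

(** Since [t 0] is trivial, the case of index 0 can be included among the
    commutations, so that for each [l] they concern an initial segment of
    indices. *)
Lemma braid_relationsE n s t : t 0 = 1 ->
  braid_relations n s t <->
  (forall l, l.+1 < n -> (0 < l -> braided (s l.+1) (t l)) /\
     (forall i, i < l -> commute (s l.+1) (t i))).
Proof.
move=> t0; split=> [[sB sC] l lt_ln|sP].
  split=> [l_gt0|[|i] lt_il]; first exact: sB.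
    by rewrite t0; apply: commute1.
  exact: sC.
split=> [i i_gt0 lt_in|i [|l] // i_gt0 lt_il lt_ln].
  by have [sB _] := sP i lt_in; apply: sB.
by have [_] := sP l lt_ln; apply.
Qed.

(** Once [s l.+1] commutes with [g l.-1], conjugation by [g l.-1] fixes it and
    carries [g l] to [s l], hence one braid relation to the other. *)
Lemma linked_braid_relations n g s : linked g s ->
  braid_relations n s g <-> braid_relations n s s.
Proof.
move=> gs.
rewrite (braid_relationsE _ _ (linked_g0 gs)).
rewrite (braid_relationsE _ _ (linked_s0 gs)).
have key l : (forall i, i < l -> commute (s l.+1) (g i)) -> 0 < l ->
    braided (s l.+1) (g l) <-> braided (s l.+1) (s l).
  case: l => // l sC _; have sJ : s l.+2 ^ g l = s l.+2.
    by rewrite conjgE sC ?mulKg.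
  by rewrite (linkedJ gs l) -{2}sJ braidedJ.
split=> sP l lt_ln; have [sB sC] := sP l lt_ln.
  have sC' := (linked_commute (s l.+1) l gs).1 sC.
  by split=> // l_gt0; apply/key => //; apply: sB.
have sC' := (linked_commute (s l.+1) l gs).2 sC.
by split=> // l_gt0; apply/key => //; apply: sB.
Qed.

Lemma descent_nil l : descent l l.+1 = [::].
Proof. by rewrite /descent subnn. Qed.

Lemma descent_rcons k l : k < l -> descent k l.+1 = rcons (descent k.+1 l.+1) k.
Proof. by move=> lt_kl; rewrite /descent /= -(subnSK lt_kl) /= rev_cons. Qed.

Lemma mem_descent k l i : (i \in descent k l.+1) = (k <= i < maxn k l).
Proof. by rewrite mem_rev mem_iota maxnE. Qed.

Lemma braided_swap x b c : c * b = b * x -> braided x b <-> x * c = b * x.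
Proof.
move=> cb; rewrite /braided -[x * b * x]mulgA -cb mulgA.
by split=> [/mulIg|->].
Qed.

Lemma gamma_relation_braided x b c :
  c * b = b * x -> c * b * c = b * c * b <-> braided x b.
Proof.
move=> cb; rewrite (braided_swap cb) cb -!mulgA cb.
by split=> [/mulgI|->].
Qed.

(** By [braided_swap], [b * w * c * b = b * w * x * c], to be compared with
    [c * b * w * c = b * x * w * c]. *)
Lemma gamma_relation_commute x b c w : c * b = b * x -> braided x b ->
  c * b * w * c = b * w * c * b <-> commute x w.
Proof.
move=> cb /(braided_swap cb) xc.
have -> : b * w * c * b = b * (w * x) * c by rewrite -mulgA cb -xc !mulgA.
have -> : c * b * w * c = b * (x * w) * c by rewrite cb !mulgA.
by split=> [/mulIg/mulgI|->].
Qed.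

(** The factor [g i] is the quotient of the descending products that end at [i]
    and at [i + 1]. *)
Lemma commute_descent g x l :
  (forall k, 0 < k -> k <= l -> commute x (\prod_(i <- descent k l.+1) g i)) <->
  (forall i, 0 < i -> i < l -> commute x (g i)).
Proof.
split=> [xW i i_gt0 lt_il|xg k k_gt0 le_kl].
  set w := \prod_(j <- descent i.+1 l.+1) g j.
  have -> : g i = w^-1 * \prod_(j <- descent i l.+1) g j.
    by rewrite descent_rcons // -cats1 big_cat big_seq1 mulKg.
  apply: commuteM (xW i i_gt0 (ltnW lt_il)).
  exact/commuteV/xW.
rewrite big_seq; apply: commute_prod => i; rewrite mem_descent.
rewrite (maxn_idPr le_kl) => /andP[le_ki lt_il].
exact: xg (leq_trans k_gt0 le_ki) lt_il.
Qed.

Lemma linked_gamma_relations n g s : linked g s ->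
  gamma_relations n g <-> braid_relations n s g.
Proof.
move=> gs; split=> [gR|[sB sC] k [//|[|l]]].
- have sB i : 0 < i -> i.+1 < n -> braided (s i.+1) (g i).
    move=> i_gt0 lt_in; apply/(gamma_relation_braided (linkedM gs i)).
    have := gR i i.+1 i_gt0 (ltnSn i) lt_in.
    by rewrite descent_nil big_nil /= !mulg1.
  split=> // i [//|l] i_gt0 lt_il lt_ln; move: i i_gt0 lt_il.
  apply/commute_descent => k k_gt0 le_kl.
  have l_gt0 := leq_trans k_gt0 le_kl.
  apply/(gamma_relation_commute _ (linkedM gs l)); first exact: sB.
  exact: gR.
- by case: k.
- move=> k_gt0 lt_kl lt_ln /=.
  apply/(gamma_relation_commute _ (linkedM gs _)); first exact: sB.
  move: k k_gt0 lt_kl; apply/commute_descent => i i_gt0 lt_il.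
  exact: sC.
Qed.

Lemma gamma_relationsE n g s : linked g s ->
  gamma_relations n g <-> braid_relations n s s.
Proof.
by move=> gs; rewrite (linked_gamma_relations n gs) linked_braid_relations.
Qed.

End Families.

(** * From words in the generators to families indexed by nat *)

Section Words.
Local Open Scope group_scope.
Variables (n : nat) (G : groupType).
Implicit Types (a : gen_index n -> G) (t : nat -> G).

Definition extend a (i : nat) : G := if insub i is Some x then a x else 1.

Lemma extend_val a x : extend a (val x) = a x.
Proof. by rewrite /extend valK. Qed.

Lemma extend0 a : extend a 0 = 1.
Proof. by rewrite /extend insubF. Qed.

Lemma gen_index_lift (s : seq nat) :
  all (fun i => 0 < i < n) s -> exists s' : seq (gen_index n), map val s' = s.
Proof.
elim: s => [|i s IH] /=; first by exists [::].
by case/andP=> lt_in /IH[s' <-]; exists (exist _ i lt_in :: s').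
Qed.

Lemma eval_pos_word t (s : seq (gen_index n)) :
  eval (t \o val) (pos_word s) = \prod_(i <- map val s) t i.
Proof. by rewrite /eval !big_map. Qed.

(** The relations of the presentation quantify over words whose letters have
    prescribed indices; the point of the direct implication is that such
    words exist, all the indices being between 1 and [n - 1]. *)
Lemma respects_gamma t :
  respects (gamma_rel n) (t \o val) <-> gamma_relations n t.
Proof.
have Elhs k l : \prod_(i <- [:: l; l.-1] ++ descent k l ++ [:: l]) t i
    = t l * t l.-1 * (\prod_(i <- descent k l) t i) * t l.
  by rewrite !(big_cat, big_cons, big_nil) /= !mulg1 !mulgA.
have Erhs k l : \prod_(i <- [:: l.-1] ++ descent k l ++ [:: l; l.-1]) t i
    = t l.-1 * (\prod_(i <- descent k l) t i) * t l * t l.-1.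
  by rewrite !(big_cat, big_cons, big_nil) /= !mulg1 !mulgA.
split=> [tR k l k_gt0 lt_kl lt_ln|tR u v [k l s s' k_gt0 lt_kl lt_ln Es Es']].
  have l_ok : 0 < l < n by rewrite (leq_trans k_gt0 (ltnW lt_kl)).
  have l1_ok : 0 < l.-1 < n.
    case: l {l_ok} lt_kl lt_ln => // l lt_kl /ltnW->.
    by rewrite (leq_trans k_gt0).
  have d_ok : all (fun i => 0 < i < n) (descent k l).
    case: l lt_kl lt_ln {l_ok l1_ok} => // l lt_kl lt_ln; apply/allP=> i.
    rewrite mem_descent (maxn_idPr (lt_kl : k <= l)) => /andP[le_ki lt_il].
    by rewrite (leq_trans k_gt0 le_ki) (ltn_trans lt_il (ltnW lt_ln)).
  have [s Es] : exists s : seq (gen_index n),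
      map val s = [:: l; l.-1] ++ descent k l ++ [:: l].
    by apply: gen_index_lift; rewrite !all_cat /= l_ok l1_ok d_ok.
  have [s' Es'] : exists s : seq (gen_index n),
      map val s = [:: l.-1] ++ descent k l ++ [:: l; l.-1].
    by apply: gen_index_lift; rewrite !all_cat /= l_ok l1_ok d_ok.
  have := tR _ _ (gamma_relation k_gt0 lt_kl lt_ln Es Es').
  by rewrite !eval_pos_word Es Es' Elhs Erhs.
by rewrite !eval_pos_word Es Es' Elhs Erhs; apply: tR.
Qed.

Lemma respects_artin t :
  respects (artin_rel n) (t \o val) <-> braid_relations n t t.
Proof.
split=> [tR|[tB tC] u v].
  have pos i : 0 < i -> i < n -> exists x : gen_index n, val x = i.
    move=> i_gt0 lt_in; have lt0in : 0 < i < n by apply/andP.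
    by exists (exist _ i lt0in).
  split=> [i i_gt0 lt_in|i j i_gt0 lt_ij lt_jn].
    have [x Ex] := pos i i_gt0 (ltnW lt_in).
    have [y Ey] := pos i.+1 isT lt_in.
    have := tR _ _ (@artin_braid n y x _); rewrite !eval_pos_word.
    rewrite /= Ex Ey !(big_cons, big_nil) !mulg1 !mulgA; apply.
    by left.
  have lt_in := ltn_trans (ltnW lt_ij) lt_jn.
  have [x Ex] := pos i i_gt0 lt_in.
  have [y Ey] := pos j (ltn_trans i_gt0 (ltnW lt_ij)) lt_jn.
  have := tR _ _ (@artin_comm n y x _); rewrite !eval_pos_word.
  rewrite /= Ex Ey !(big_cons, big_nil) !mulg1; apply.
  by right.
have valn (x : gen_index n) : 0 < val x /\ val x < n.
  by apply/andP; apply: valP x.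
case=> x y; have [x_gt0 lt_xn] := valn x; have [y_gt0 lt_yn] := valn y;
  rewrite !eval_pos_word !(big_cons, big_nil) !mulg1 ?mulgA.
- case=> E; rewrite E in lt_xn lt_yn *; first exact: tB.
  exact/esym/tB.
- case=> lt_xy; [apply/commute_sym|]; exact: tC.
Qed.

Lemma respects_extend rel a : respects rel a -> respects rel (extend a \o val).
Proof.
move=> rel_a u v /rel_a; congr (_ = _); apply: eq_bigr => p _ /=;
  by rewrite extend_val.
Qed.

End Words.

Lemma extend_morph (n : nat) (G H : groupType) (f : {multiplicative G -> H})
    (a : gen_index n -> G) (t : nat -> H) :
  t 0 = 1%g -> (forall x, f (a x) = t (val x)) ->
  forall i, i < n -> f (extend a i) = t i.
Proof.
move=> t0 fa [|i] lt_in; first by rewrite extend0 multiplicative1 t0.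
have lt0in : 0 < i.+1 < n by [].
by rewrite -[i.+1]/(val (exist _ i.+1 lt0in : gen_index n)) extend_val fa.
Qed.

Lemma linked_morph (G H : groupType) (f : {multiplicative G -> H})
    (g s : nat -> G) : linked g s -> linked (f \o g) (f \o s).
Proof.
move=> [g0 s0 gsM]; split=> [||i] /=; last by rewrite -!gmulfM gsM.
  by rewrite g0 multiplicative1.
by rewrite s0 multiplicative1.
Qed.

Theorem theorem4p1 (n : nat) (hn : 3 <= n) :
  exists gamma : gen_index n -> braid_group n,
    presented_by (gamma_rel n) gamma.
Proof.
pose sigma := extend (pg_gen (artin_rel n)).
pose gamma := extend (pg_gen (gamma_rel n)).
have sigma0 : sigma 0 = 1%g by exact: extend0.
have gamma0 : gamma 0 = 1%g by exact: extend0.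
have sigmaR : braid_relations n sigma sigma.
  exact/respects_artin/respects_extend/respects_pg_gen.
have gammaR : gamma_relations n gamma.
  exact/respects_gamma/respects_extend/respects_pg_gen.
have linkB := linked_gammas sigma0.
have linkC := linked_sigmas gamma0.
exists (gammas sigma \o val).
apply: (@presented_by_inverse _ _ _ _ _ (sigmas gamma \o val)).
- exact/respects_gamma/(gamma_relationsE n linkB).
- exact/respects_artin/(gamma_relationsE n linkC).
(* The image of [gamma] under [f] is [gammas sigma] at all indices below [n], so
   the families linked to them agree there; likewise for [h]. *)
- move=> f fE y /=; have [_ lt_yn] := andP (valP y).
  rewrite -(extend_val (pg_gen (artin_rel n)) y).
  apply: (linked_eqr (linked_morph f linkC) linkB) lt_yn.
  exact: extend_morph (linked_g0 linkB) fE.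
- move=> h hE x /=; have [_ lt_xn] := andP (valP x).
  rewrite -(extend_val (pg_gen (gamma_rel n)) x).
  apply: (linked_eql (linked_morph h linkB) linkC) lt_xn.
  exact: extend_morph (linked_s0 linkC) hE.
Qed.
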